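(* For any finite simple graph $G$ of order $n$ and minimum degree $\delta(G)\geq 2$, $$\gamma_{\times 2}(G)\leq \min\{\alpha(G),\,n-\alpha(G)\}+\gamma(G),$$ where $\gamma_{\times 2}(G)$ is the double domination number, $\alpha(G)$ the independence number and $\gamma(G)$ the domination number of $G$.
   Context: Graphs are finite and simple; the order of $G$ is $n=|V(G)|$. For a vertex $v\in V(G)$, the open neighbourhood is $N(v)=\{u\in V(G): u \text{ is adjacent to } v\}$ and the closed neighbourhood is $N[v]=N(v)\cup\{v\}$. A set $D\subseteq V(G)$ is a dominating set if $|D\cap N[v]|\ge 1$ for every $v\in V(G)$; the domination number $\gamma(G)$ is the minimum cardinality of a dominating set. A set $D\subseteq V(G)$ is a double dominating set (2-tuple dominating set) if $|D\cap N[v]|\ge 2$ for every $v\in V(G)$ (including the vertices of $D$); the double domination number $\gamma_{\times 2}(G)$ is the minimum cardinality of a double dominating set. The independence number $\alpha(G)$ is the maximum cardinality of a set of pairwise non-adjacent vertices of $G$. *)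

(* Defs.v *)
From mathcomp Require Import all_boot.

Set Implicit Arguments.
Unset Strict Implicit.
Unset Printing Implicit Defensive.

(* A finite simple graph is a symmetric irreflexive relation e on a finType T;
   its order is #|T|. *)
Section Graph.
Variables (T : finType) (e : rel T).

Definition open_nbh (v : T) : {set T} := [set u | e v u].
Definition closed_nbh (v : T) : {set T} := v |: open_nbh v.

Definition degree (v : T) : nat := #|open_nbh v|.

Definition dominating (D : {set T}) : bool :=
  [forall v, 1 <= #|D :&: closed_nbh v|].

Definition double_dominating (D : {set T}) : bool :=
  [forall v, 2 <= #|D :&: closed_nbh v|].

Definition independent (S : {set T}) : bool :=
  [forall u in S, forall v in S, ~~ e u v].

(* The minima below start from #|T|, an upper bound for all the cardinals
   involved, so they are the true minima whenever the family is nonempty.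
   If T is empty then min_degree is 0; if the graph has an isolated vertex,
   there is no double dominating set and double_domination_number is #|T|. *)
Definition min_degree : nat := \big[minn/#|T|]_(v : T) degree v.

Definition domination_number : nat :=
  \big[minn/#|T|]_(D : {set T} | dominating D) #|D|.

Definition double_domination_number : nat :=
  \big[minn/#|T|]_(D : {set T} | double_dominating D) #|D|.

Definition independence_number : nat :=
  \max_(S : {set T} | independent S) #|S|.

End Graph.

(* Main.v *)
Require Import Defs.
From mathcomp Require Import all_boot.

Set Implicit Arguments.
Unset Strict Implicit.
Unset Printing Implicit Defensive.

(** Call a vertex deficient for a set [Y] if its closed neighbourhood meets [Y]
    at most once.  If all deficient vertices lie in [Y], adding one neighbour
    of each of them makes [Y] double dominating, at a cost of at most one
    vertex per deficient vertex ([double_domination_number_repair]).  Both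
    bounds come from a choice of [Y] that contains a minimum dominating set
    [D] and whose deficient vertices are few.

    For the bound by the independence number, [Y] is the union of [D] and of a
    maximal independent subset [I] of the complement of [D].  A vertex outside
    [D] is dominated once by [D], and once more by [I], so the deficient
    vertices lie in [D].  They have no neighbour in [D] or in [I], hence their
    union with [I] is independent, and has at most as many elements as the
    independence number.

    For the bound by its complement, [Y] is the union of [D] and of the
    complement [C] of a maximum independent set.  A vertex outside [C] has all
    its neighbours in [C], and there are at least two of them; a vertex of
    [C] outside [D] is dominated by itself and by [D].  So the deficient
    vertices lie in both [C] and [D], and the repair costs at most the number
    of vertices counted twice in [#|C| + #|D|]. *)

(** The index of the minimum is itself a value of the family as soon as
    [P setT] holds, so the minimum is attained. *)
Lemma bigmin_card_attained (T : finType) (P : pred {set T}) :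
  P setT -> exists2 D, P D & #|D| = \big[minn/#|T|]_(D : {set T} | P D) #|D|.
Proof.
move=> PT; apply: (big_ind (fun m => exists2 D, P D & #|D| = m)).
- by exists setT => //; rewrite cardsT.
- by move=> m1 m2 ex1 ex2; rewrite /minn; case: ifP.
- by move=> D PD; exists D.
Qed.

Lemma bigmin_leq (I : finType) (P : pred I) (F : I -> nat) (m : nat) (i : I) :
  P i -> \big[minn/m]_(j | P j) F j <= F i.
Proof.
move=> Pi; have := mem_index_enum i.
elim: (index_enum I) => [//|j r IHr]; rewrite inE big_cons => /predU1P[<-|/IHr le_r].
  by rewrite Pi geq_minl.
by case: ifP => // _; rewrite geq_min le_r orbT.
Qed.

Section DoubleDomination.
Variables (T : finType) (e : rel T).
Hypotheses (e_sym : symmetric e) (e_irr : irreflexive e).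

Implicit Types (u v w : T) (D I S X Y : {set T}).

Lemma in_closed_nbh u v : (u \in closed_nbh e v) = (u == v) || e v u.
Proof. by rewrite !inE. Qed.

Lemma min_degree_leq v : min_degree e <= degree e v.
Proof. exact: bigmin_leq. Qed.

Lemma double_domination_number_leq X :
  double_dominating e X -> double_domination_number e <= #|X|.
Proof. exact: bigmin_leq. Qed.

Lemma independence_number_geq S :
  independent e S -> #|S| <= independence_number e.
Proof. exact: leq_bigmax_cond. Qed.

Lemma domination_number_attained :
  exists2 D, dominating e D & #|D| = domination_number e.
Proof.
apply: bigmin_card_attained; apply/forallP => v.
by rewrite setTI card_gt0; apply/set0Pn; exists v; rewrite in_closed_nbh eqxx.
Qed.

Lemma independence_number_attained :
  exists2 S, independent e S & #|S| = independence_number e.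
Proof.
have indep0 : 0 < #|[pred S | independent e S]|.
  by apply/card_gt0P; exists set0; apply/forall_inP => u; rewrite inE.
by have [S indS eqS] := eq_bigmax_cond (fun S => #|S|) indep0; exists S.
Qed.

Lemma dominatingP D v : dominating e D -> exists2 u, u \in D & (u == v) || e v u.
Proof.
move=> /forallP/(_ v); rewrite card_gt0 => /set0Pn[u].
by rewrite inE in_closed_nbh => /andP[uD uv]; exists u.
Qed.

Lemma independentP S :
  reflect {in S &, forall u v, ~~ e u v} (independent e S).
Proof.
apply: (iffP forall_inP) => [indS u v uS vS | indS u uS].
  by have /forall_inP := indS u uS; apply.
by apply/forall_inP => v vS; apply: indS.
Qed.

Definition deficient Y : {set T} := [set v | #|Y :&: closed_nbh e v| < 2].

Lemma not_deficient Y v u w :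
  u \in Y -> w \in Y -> u != w -> (u == v) || e v u -> (w == v) || e v w ->
  v \notin deficient Y.
Proof.
move=> uY wY neq_uw uv wv; rewrite inE -leqNgt; apply/card_gt1P.
by exists u, w; split; rewrite // in_setI in_closed_nbh ?uY ?wY.
Qed.

(** The vertex [v] already counts once in its own closed neighbourhood, so a
    neighbour in [Y] would be a second element of [Y] there. *)
Lemma deficient_nbr Y v u :
  v \in Y -> v \in deficient Y -> e v u -> u \notin Y.
Proof.
move=> vY defv evu; apply: contraL defv => uY.
apply: (not_deficient vY uY); rewrite ?eqxx ?evu ?orbT //.
by apply: contraTneq evu => <-; rewrite e_irr.
Qed.

(** A deficient vertex of [Y] is dominated by itself, so a single neighbour is
    enough to dominate it twice; vertices that are not deficient are not
    affected by enlarging [Y]. *)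
Lemma double_domination_number_repair Y :
  (forall v, 0 < degree e v) -> deficient Y \subset Y ->
  double_domination_number e <= #|Y| + #|deficient Y|.
Proof.
move=> deg_gt0 /subsetP defY.
have nbr v : exists u, e v u.
  by have := deg_gt0 v; rewrite card_gt0 => /set0Pn[u]; rewrite inE; exists u.
pose f v := xchoose (nbr v).
have fP v : e v (f v) by apply: xchooseP.
apply: (@leq_trans #|Y :|: f @: deficient Y|); last first.
  by rewrite (leq_trans (leq_card_setU _ _)) // leq_add2l leq_imset_card.
apply/double_domination_number_leq/forallP => v.
have [defv|] := boolP (v \in deficient Y); last first.
  rewrite inE -leqNgt => /leq_trans; apply.
  by apply: subset_leq_card; apply: setSI; apply: subsetUl.
apply/card_gt1P; exists v, (f v).
split; first by rewrite inE in_closed_nbh eqxx inE defY.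
  by rewrite inE in_closed_nbh fP orbT inE imset_f // orbT.
by apply: contraTneq (fP v) => <-; rewrite e_irr.
Qed.

(** Maximality turns an independent subset of [A] into a dominating set of the
    subgraph induced on [A]; with [A] the complement of a dominating set, it
    supplies the second domination of the vertices of [A]. *)
Lemma exists_maximal_independent (A : {set T}) :
  exists I, [/\ independent e I, I \subset A &
    forall v, v \in A -> v \notin I -> exists2 u, u \in I & e v u].
Proof.
pose P I := independent e I && (I \subset A).
have P0 : P set0 by rewrite /P sub0set andbT; apply/independentP => u; rewrite inE.
have [I /maxsetP[/andP[indI subI] maxI] _] := maxset_exists P0.
exists I; split=> // v vA vnI; apply/exists_inP; apply: contraNT vnI.
rewrite negb_exists_in => /forall_inP nbr.
rewrite -(maxI (v |: I)) ?setU11 ?subsetUr //.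
rewrite /P subUset sub1set vA subI !andbT; apply/independentP => x y.
rewrite !inE => /predU1P[->|xI] /predU1P[->|yI]; first by rewrite e_irr.
- exact: nbr.
- by rewrite e_sym; apply: nbr.
- exact: (independentP _ indI).
Qed.

(** The repair is paid for by the independence number: the deficient vertices
    of [D :|: I] can be added to [I] without creating an edge. *)
Lemma double_domination_leq_independence :
  (forall v, 0 < degree e v) ->
  double_domination_number e <= independence_number e + domination_number e.
Proof.
move=> deg_gt0; have [D domD <-] := domination_number_attained.
have [I [indI subI maxI]] := exists_maximal_independent (~: D).
have InD u : u \in I -> u \notin D by move/(subsetP subI); rewrite inE.
pose Y := D :|: I; pose B := deficient Y.
have subBD : B \subset D.
  apply/subsetP => v; apply: contraLR => vnD.
  have [u uD uv] := dominatingP v domD.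
  (* The second dominator is [v] itself if [v] is in [I]. *)
  have [w wI wv] : exists2 w, w \in I & (w == v) || e v w.
    have [vI|vnI] := boolP (v \in I); first by exists v; rewrite ?eqxx.
    have [|w wI evw] := maxI v _ vnI; first by rewrite inE.
    by exists w; rewrite ?evw ?orbT.
  apply: (@not_deficient _ _ u w) => //; rewrite ?inE ?uD ?wI ?orbT //.
  by apply: contraTneq uD => ->; apply: InD.
have subBY : B \subset Y := subset_trans subBD (subsetUl _ _).
have nbrB v u : v \in B -> u \in Y -> ~~ e v u.
  move=> vB; apply: contraL; exact: deficient_nbr (subsetP subBY v vB) vB.
have indBI : independent e (B :|: I).
  apply/independentP => x y; rewrite !in_setU.
  move=> /orP[xB|xI] /orP[yB|yI].
  - exact: nbrB (subsetP subBY y yB).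
  - by apply: nbrB; rewrite // inE yI orbT.
  - by rewrite e_sym; apply: nbrB; rewrite // inE xI orbT.
  - exact: (independentP _ indI).
have disjBI : [disjoint B & I].
  apply/pred0P => v /=; apply/negP => /andP[/(subsetP subBD) vD /InD].
  by rewrite vD.
have cardBI : #|B :|: I| = #|B| + #|I| by apply/eqP; rewrite (leq_card_setU B I).
apply: leq_trans (double_domination_number_repair deg_gt0 subBY) _.
apply: (@leq_trans (#|D| + #|I| + #|B|)).
  by rewrite leq_add2r leq_card_setU.
rewrite -addnA addnC leq_add2r addnC -cardBI.
exact: independence_number_geq.
Qed.

(** The complement of an independent set is a vertex cover [C], so minimum
    degree two makes [C] alone dominate twice every vertex outside [C]; the
    repair is paid for by the overlap of [C] with [D]. *)
Lemma double_domination_leq_cover :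
  (forall v, 2 <= degree e v) ->
  double_domination_number e <=
    #|T| - independence_number e + domination_number e.
Proof.
move=> deg_ge2; have [D domD <-] := domination_number_attained.
have [S /independentP indS <-] := independence_number_attained.
pose C := ~: S; have -> : #|T| - #|S| = #|C| by rewrite [#|C|]cardsCs setCK.
pose Y := C :|: D.
have subBCD : deficient Y \subset C :&: D.
  apply/subsetP => v; apply: contraLR; rewrite in_setI negb_and.
  have [vC|vnC _] := boolP (v \in C); last first.
    have vS : v \in S by rewrite inE negbK in vnC.
    rewrite inE -leqNgt; apply: leq_trans (deg_ge2 v) _.
    apply: subset_leq_card; apply/subsetP => u; rewrite inE => evu.
    rewrite !inE evu !orbT andbT; apply/orP; left.
    by apply: contraL evu; apply: indS.
  move=> /= vnD; have [u uD uv] := dominatingP v domD.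
  apply: (@not_deficient _ _ v u) => //; rewrite ?eqxx // ?in_setU ?vC ?uD ?orbT //.
  by apply: contraNneq vnD => ->.
have subBY : deficient Y \subset Y.
  by apply: subset_trans subBCD _; rewrite subIset // subsetUl.
apply: leq_trans (double_domination_number_repair _ subBY) _.
  by move=> v; apply: ltnW.
rewrite -(cardsUI C D) leq_add2l; exact: subset_leq_card.
Qed.

End DoubleDomination.

Theorem theorem2p6 (T : finType) (e : rel T)
    (e_sym : symmetric e) (e_irr : irreflexive e)
    (min_deg : 2 <= min_degree e) :
  double_domination_number e <=
    minn (independence_number e) (#|T| - independence_number e)
    + domination_number e.
Proof.
have deg_ge2 v : 2 <= degree e v := leq_trans min_deg (min_degree_leq e v).
rewrite addn_minl leq_min double_domination_leq_independence //=.
  exact: double_domination_leq_cover.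
by move=> v; apply: ltnW.
Qed.
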